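(* Let $p$ be a prime and let $q\in U^{(1)}-\{1\}$. If $p\neq 3$ or $q\in U^{(2)}$, then the only $z\in\mathbb{Z}_p$ with $\iota_q(z)=z$ are the trivial fixed points $z=0$ and $z=1$.
   Context: $\mathbb{Z}_p$ is the ring of $p$-adic integers and $U^{(m)}=1+p^m\mathbb{Z}_p$. For $q\in U^{(1)}$, $\iota_q:\mathbb{Z}_p\to\mathbb{Z}_p$ is the unique continuous function with $\iota_q(n)=1+q+\cdots+q^{n-1}$ for all integers $n\ge 0$; thus $\iota_q(z)=(q^z-1)/(q-1)$ for $q\ne 1$. *)

(* Defs.v *)
From HB Require Import structures.
From mathcomp Require Import all_boot all_order all_algebra.
From mathcomp Require Import boolp classical_sets topology.

Set Implicit Arguments.
Unset Strict Implicit.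
Unset Printing Implicit Defensive.
Import GRing.Theory.
Local Open Scope classical_set_scope.
Local Open Scope ring_scope.

(* The ring of p-adic integers as the inverse limit of the rings Z/p^(n+1)Z.
   Starting at exponent 1 keeps every modulus > 1 when p is prime, so that
   'Z_(p ^ n.+1) really is Z/p^(n+1)Z; the type is meaningful for p > 1 only. *)
Record padic (p : nat) : Type := Padic {
  residue :> forall n : nat, 'Z_(p ^ n.+1);
  residue_coherent : forall n : nat,
    residue n = (residue n.+1 : nat)%:R :> 'Z_(p ^ n.+1)
}.

Lemma padic_ext (p : nat) (x y : padic p) : (forall n, x n = y n) -> x = y.
Proof.
case: x y => [x hx] [y hy] /= e.
have exy : x = y by apply: functional_extensionality_dep.
rewrite -exy in hy *; congr Padic; exact: Prop_irrelevance.
Qed.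

Section Ring.
Variable p : nat.

Let M n := (Zp_trunc (p ^ n.+1)).+2.

Let dvdM n : (M n %| M n.+1)%N.
Proof.
rewrite /M; case: p => [|[|k]]; rewrite ?exp0n ?exp1n //.
have gt1 m : (1 < k.+2 ^ m.+1)%N by rewrite -[1%N](expn0 k.+2) ltn_exp2l.
by rewrite !Zp_cast ?dvdn_exp2l.
Qed.

Let natE n (k : nat) : (k%:R : 'Z_(p ^ n.+1)) = inZp k.
Proof. by rewrite Zp_nat. Qed.

Let modM n (k : nat) : ((k %% M n.+1)%N%:R : 'Z_(p ^ n.+1)) = k%:R.
Proof. by rewrite !natE; apply: val_inj; exact: modn_dvdm (dvdM n). Qed.

Lemma padic_nat_subproof (k n : nat) :
  k%:R = (k%:R : 'Z_(p ^ n.+2)) %:R :> 'Z_(p ^ n.+1).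
Proof. by rewrite (natE n.+1) /= modM. Qed.

Lemma padic_add_subproof (x y : padic p) (n : nat) :
  x n + y n = (x n.+1 + y n.+1)%R %:R :> 'Z_(p ^ n.+1).
Proof. by rewrite /= modM natrD -!residue_coherent. Qed.

Lemma padic_mul_subproof (x y : padic p) (n : nat) :
  x n * y n = (x n.+1 * y n.+1)%R %:R :> 'Z_(p ^ n.+1).
Proof. by rewrite /= modM natrM -!residue_coherent. Qed.

Lemma padic_opp_subproof (x : padic p) (n : nat) :
  - x n = (- x n.+1)%R %:R :> 'Z_(p ^ n.+1).
Proof.
have := residue_coherent x n; move: (x n) (x n.+1) => a b ->.
apply/eqP; rewrite eq_sym -addr_eq0 /= modM -natrD subnK ?(ltnW (ltn_ord b)) //.
rewrite natE; apply/eqP/val_inj; apply/eqP; exact: dvdM.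
Qed.

Definition padic_nat (k : nat) : padic p := Padic (padic_nat_subproof k).
Definition padic_add (x y : padic p) : padic p :=
  Padic (padic_add_subproof x y).
Definition padic_mul (x y : padic p) : padic p :=
  Padic (padic_mul_subproof x y).
Definition padic_opp (x : padic p) : padic p := Padic (padic_opp_subproof x).

Lemma padic_addA : associative padic_add.
Proof. by move=> x y z; apply: padic_ext => n; exact: addrA. Qed.
Lemma padic_addC : commutative padic_add.
Proof. by move=> x y; apply: padic_ext => n; exact: addrC. Qed.
Lemma padic_add0 : left_id (padic_nat 0) padic_add.
Proof. by move=> x; apply: padic_ext => n; exact: add0r. Qed.
Lemma padic_addN : left_inverse (padic_nat 0) padic_opp padic_add.
Proof. by move=> x; apply: padic_ext => n; exact: addNr. Qed.
Lemma padic_mulA : associative padic_mul.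
Proof. by move=> x y z; apply: padic_ext => n; exact: mulrA. Qed.
Lemma padic_mulC : commutative padic_mul.
Proof. by move=> x y; apply: padic_ext => n; exact: mulrC. Qed.
Lemma padic_mul1 : left_id (padic_nat 1) padic_mul.
Proof. by move=> x; apply: padic_ext => n; exact: mul1r. Qed.
Lemma padic_mulD : left_distributive padic_mul padic_add.
Proof. by move=> x y z; apply: padic_ext => n; exact: mulrDl. Qed.

HB.instance Definition _ := gen_eqMixin (padic p).
HB.instance Definition _ := gen_choiceMixin (padic p).
HB.instance Definition _ := GRing.isZmodule.Build (padic p)
  padic_addA padic_addC padic_add0 padic_addN.

Lemma padic_1neq0 : padic_nat 1 != 0.
Proof.
apply/eqP => /(congr1 (fun x : padic p => x 0%N)) /= /eqP.
by rewrite oner_eq0.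
Qed.

HB.instance Definition _ := GRing.Zmodule_isComNzRing.Build (padic p)
  padic_mulA padic_mulC padic_mul1 padic_mulD padic_1neq0.

Lemma residueD (x y : padic p) n : (x + y) n = x n + y n. Proof. by []. Qed.
Lemma residueN (x : padic p) n : (- x) n = - x n. Proof. by []. Qed.
Lemma residueB (x y : padic p) n : (x - y) n = x n - y n. Proof. by []. Qed.
Lemma residueM (x y : padic p) n : (x * y) n = x n * y n. Proof. by []. Qed.
Lemma residue_nat (k n : nat) : (k%:R : padic p) n = k%:R.
Proof. by elim: k => // k IH; rewrite -!natr1 residueD IH. Qed.

End Ring.

(* The coset x + p^n Z_p; these form the neighbourhood basis of the p-adic
   topology. *)
Definition pcoset (p : nat) (n : nat) (x : padic p) : set (padic p) :=
  [set x + p%:R ^+ n * y | y in [set: padic p]].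

Definition padic_nbhs (p : nat) (x : padic p) : set (set (padic p)) :=
  [set A | exists n, pcoset n x `<=` A].

Section Topology.
Variable p : nat.

HB.instance Definition _ := hasNbhs.Build (padic p) (@padic_nbhs p).

Lemma pcoset_refl n (x : padic p) : pcoset n x x.
Proof. by exists 0 => //; rewrite mulr0 addr0. Qed.

Lemma pcoset_trans n (x y z : padic p) :
  pcoset n x y -> pcoset n y z -> pcoset n x z.
Proof.
by move=> [a _ <-] [b _ <-]; exists (a + b) => //; rewrite mulrDr addrA.
Qed.

Lemma pcoset_sym n (x y : padic p) : pcoset n x y -> pcoset n y x.
Proof. by move=> [a _ <-]; exists (- a) => //; rewrite mulrN addrK. Qed.

Lemma pcoset_le m n (x : padic p) : (m <= n)%N -> pcoset n x `<=` pcoset m x.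
Proof.
move=> mn _ [a _ <-]; exists (p%:R ^+ (n - m) * a) => //.
by rewrite mulrA -exprD subnKC.
Qed.

Lemma padic_nbhs_filter (x : padic p) : ProperFilter (nbhs x).
Proof.
split; first by case=> n /(_ x (pcoset_refl n x)).
split.
- by exists 0%N.
- move=> A B [m mA] [n nB]; exists (maxn m n) => y yx; split.
    by apply: mA; apply: pcoset_le yx; rewrite leq_maxl.
  by apply: nB; apply: pcoset_le yx; rewrite leq_maxr.
- by move=> A B AB [m mA]; exists m; apply: subset_trans AB.
Qed.

Lemma padic_nbhs_singleton (x : padic p) (A : set (padic p)) :
  nbhs x A -> A x.
Proof. by case=> n; apply; exact: pcoset_refl. Qed.

Lemma padic_nbhs_nbhs (x : padic p) (A : set (padic p)) :
  nbhs x A -> nbhs x (nbhs^~ A).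
Proof.
case=> n nA; exists n => y yx; exists n => z zy.
by apply: nA; apply: pcoset_trans zy.
Qed.

HB.instance Definition _ := Nbhs_isNbhsTopological.Build (padic p)
  padic_nbhs_filter padic_nbhs_singleton padic_nbhs_nbhs.

End Topology.

Definition U (p : nat) (m : nat) : set (padic p) := pcoset m 1.

Definition qsum (p : nat) (q : padic p) (n : nat) : padic p :=
  \sum_(i < n) q ^+ i.

Definition interpolates_qsum (p : nat) (q : padic p) (f : padic p -> padic p) :=
  continuous f /\ forall n : nat, f n%:R = qsum q n.

(* The unique continuous function interpolating [qsum q]; existence and
   uniqueness for q in U^(1) are proved below, the default value [id] being
   used only for other q. *)
Definition iota_q (p : nat) (q : padic p) : padic p -> padic p :=
  xget (id : padic p -> padic p) (interpolates_qsum q).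

Section Interpolation.
Variables (p : nat) (p_pr : prime p).

Let pn_gt1 n : (1 < p ^ n.+1)%N.
Proof. by rewrite -[1%N](expn0 p) ltn_exp2l // prime_gt1. Qed.

Lemma residue_mod (x : padic p) (n k : nat) :
  x n = (x (n + k)%N : nat)%:R :> 'Z_(p ^ n.+1).
Proof.
elim: k => [|k IH]; first by rewrite addn0 natr_Zp.
rewrite IH addnS (residue_coherent x (n + k)).
apply: val_inj; rewrite /= !val_Zp_nat // modn_dvdm //.
by rewrite dvdn_exp2l // ltnS leq_addr.
Qed.

Lemma pcosetP (n : nat) (x y : padic p) : pcoset n.+1 x y <-> x n = y n.
Proof.
split=> [[z _ <-]|].
  rewrite residueD residueM -natrX residue_nat.
  suff -> : (p ^ n.+1)%N%:R = 0 :> 'Z_(p ^ n.+1) by rewrite mul0r addr0.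
  by apply: val_inj; rewrite /= val_Zp_nat // modnn.
move=> e; have [w xw w0] : exists2 w, x + w = y & w n = 0.
  by exists (y - x); rewrite ?residueB ?e ?subrr // addrC subrK.
pose W j : nat := w j.
have W_coh j : W j = (W j.+1 %% p ^ j.+1)%N.
  by rewrite /W (residue_coherent w j) val_Zp_nat.
have dvdW k : (p ^ n.+1 %| W (n.+1 + k)%N)%N.
  have := residue_mod w n k.+1; rewrite w0.
  move/(congr1 val); rewrite /= val_Zp_nat // => /esym/eqP.
  by rewrite -[w _ : nat]/(W _) addnS addSn.
have pn_gt0 m : (0 < p ^ m)%N by rewrite expn_gt0 prime_gt0.
pose v k : 'Z_(p ^ k.+1) := (W (n.+1 + k) %/ p ^ n.+1)%N%:R.
have v_coh k : v k = (v k.+1 : nat)%:R :> 'Z_(p ^ k.+1).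
  apply: val_inj; rewrite /v /= !val_Zp_nat // modn_dvdm ?dvdn_exp2l //.
  rewrite W_coh -addnS; have /dvdnP[c ->] := dvdW k.+1.
  by rewrite expnD [(c * _)%N]mulnC -muln_modr !mulKn // modn_mod.
exists (Padic v_coh) => //; rewrite -natrX -xw; congr (x + _).
apply: padic_ext => k; rewrite residueM residue_nat /= /v -natrM.
by rewrite mulnC divnK ?dvdW // addnC -residue_mod.
Qed.

Lemma pcoset_natr (n : nat) (x : padic p) :
  pcoset n.+1 x (x n : nat)%:R.
Proof. by apply/pcosetP; rewrite residue_nat natr_Zp. Qed.

Lemma interpolates_qsum_unique (q : padic p) (f g : padic p -> padic p) :
  interpolates_qsum q f -> interpolates_qsum q g -> f = g.
Proof.
move=> [cf fN] [cg gN]; apply/funext => z; apply: padic_ext => n.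
have nb (h : padic p -> padic p) : continuous h -> exists m, forall w, pcoset m z w ->
    pcoset n.+1 (h z) (h w).
  move=> /(_ z (pcoset n.+1 (h z))) []; first by exists n.+1.
  by move=> m hm; exists m => w /hm.
have [m1 h1] := nb f cf; have [m2 h2] := nb g cg.
pose m := maxn m1 m2; have zw := pcoset_natr m z.
have /pcosetP -> := h1 _ (pcoset_le (leqW (leq_maxl m1 m2)) zw).
have /pcosetP -> := h2 _ (pcoset_le (leqW (leq_maxr m1 m2)) zw).
by rewrite fN gN.
Qed.

Lemma qsumD (q : padic p) (a b : nat) :
  qsum q (a + b) = qsum q a + q ^+ a * qsum q b.
Proof.
rewrite /qsum big_split_ord /= mulr_sumr; congr (_ + _).
by apply: eq_bigr => i _; rewrite exprD.
Qed.

Lemma qsumM (q : padic p) (a b : nat) :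
  qsum q (a * b) = qsum q a * qsum (q ^+ a) b.
Proof.
elim: b => [|b IH]; first by rewrite muln0 /qsum !big_ord0 mulr0.
rewrite mulnS addnC qsumD IH /qsum [in RHS]big_ord_recr /= mulrDr -exprM.
by congr (_ + _); rewrite mulrC.
Qed.

Lemma U1X (q : padic p) (a : nat) : U 1 q -> U 1 (q ^+ a).
Proof.
case=> y _ <-; elim: a => [|a [z _ IH]]; first exact: pcoset_refl.
exists (y + z * (1 + p%:R ^+ 1 * y)) => //.
rewrite [_ ^+ a.+1]exprS -IH mulrDr addrA.
by rewrite [RHS]mulrDr mulr1; congr (_ + _); rewrite mulrA mulrC.
Qed.

Lemma qsum_p (q : padic p) : U 1 q -> exists y, qsum q p = p%:R * y.
Proof.
move=> qU.
have /choice[y yE] : forall i, exists y, q ^+ i = 1 + p%:R * y.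
  by move=> i; have [y _ <-] := U1X i qU; exists y.
exists (1 + \sum_(i < p) y i); rewrite /qsum.
under eq_bigr => i _ do rewrite yE.
rewrite big_split /= -mulr_sumr mulrDr mulr1; congr (_ + _).
by rewrite sumr_const card_ord.
Qed.

Lemma qsum_pX (q : padic p) (k : nat) : U 1 q ->
  exists y, qsum q (p ^ k) = p%:R ^+ k * y.
Proof.
move=> qU; elim: k => [|k [y IH]].
  by exists 1; rewrite /qsum expn0 big_ord1 expr0 mulr1.
have [z zE] := qsum_p (U1X (p ^ k) qU).
exists (y * z); rewrite expnSr qsumM IH zE exprSr.
by rewrite -!mulrA; congr (_ * _); rewrite mulrCA.
Qed.

Lemma qsum_mod (q : padic p) (n a : nat) : U 1 q ->
  qsum q a n = qsum q (a %% p ^ n.+1) n.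
Proof.
move=> qU; apply/esym/pcosetP.
rewrite {2}(divn_eq a (p ^ n.+1)) addnC qsumD mulnC qsumM.
have [y ->] := qsum_pX n.+1 qU.
set s := qsum _ _; set t := qsum (_ ^+ _) _; set u := q ^+ _.
exists (y * t * u) => //.
by rewrite [u * _]mulrC !mulrA.
Qed.

Lemma iota_subproof (q z : padic p) (qU : U 1 q) (n : nat) :
  qsum q (z n) n = (qsum q (z n.+1) n.+1 : nat)%:R :> 'Z_(p ^ n.+1).
Proof.
rewrite -residue_coherent (residue_coherent z n) val_Zp_nat //.
by rewrite -qsum_mod.
Qed.

Lemma interpolates_qsum_exists (q : padic p) : U 1 q ->
  exists f, interpolates_qsum q f.
Proof.
move=> qU; exists (fun z => Padic (iota_subproof z qU)); split.
  move=> z A [n nA]; exists n.+1 => w /pcosetP zw; apply: nA.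
  by apply: (@pcoset_le _ _ n.+1) => //; apply/pcosetP; rewrite /= zw.
move=> k; apply: padic_ext => n /=.
by rewrite residue_nat val_Zp_nat // -qsum_mod.
Qed.

Lemma iota_qP (q : padic p) : U 1 q -> interpolates_qsum q (iota_q q).
Proof. by move=> /interpolates_qsum_exists[f]; exact: xgetI. Qed.

End Interpolation.

(* Main.v *)
(* Put q = 1 + t. By the binomial theorem
   2 (iota_q n - n) = n (n - 1) t + \sum_(k >= 3) 2 'C(n, k) t^(k - 1),
   and k (k - 1) 'C(n, k) = n (n - 1) 'C(n - 2, k - 2) shows that each term
   with k >= 3 has larger p-adic valuation than n (n - 1) t; the hypothesis on
   p and q is what the term k = 3 requires. Hence the valuation of
   2 (iota_q n - n) is that of n (n - 1) t, and approximating a fixed point z by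
   integers n yields z (z - 1) t = 0. *)
Require Import Defs.
From mathcomp Require Import all_boot all_order all_algebra.
From mathcomp Require Import boolp classical_sets topology.
From mathcomp Require Import zify.
Import GRing.Theory.
Local Open Scope classical_set_scope.
Local Open Scope ring_scope.

(** Since [k.+1] and [k.+2] are coprime, [p] divides at most one of them, so the whole power of [p]
    sits in a single factor. *)
Lemma logn_consecutive_le (p k : nat) : prime p ->
  (p ^ logn p (k.+2 * k.+1) <= k.+2)%N.
Proof.
move=> p_pr; rewrite lognM //.
have [pk|pk] := boolP (p %| k.+1)%N.
  have -> : logn p k.+2 = 0%N.
    apply/eqP; rewrite -leqn0 leqNgt logn_gt0 mem_primes p_pr /=.
    by rewrite -addn1 dvdn_addr // dvdn1; move: (prime_gt1 p_pr); lia.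
  by rewrite add0n (leq_trans (dvdn_leq _ (pfactor_dvdnn p k.+1))).
have -> : logn p k.+1 = 0%N.
  by apply/eqP; rewrite -leqn0 leqNgt logn_gt0 mem_primes p_pr /=.
by rewrite addn0 dvdn_leq ?pfactor_dvdnn.
Qed.

(** Here [m] stands for the valuation of t. Failure would give [p ^ e <= k.+3] with [e >= k.+1], and
    even [e >= k.+2] for [p = 2], against exponential growth. *)
Lemma logn_consecutive_lt (p m k : nat) : prime p -> (0 < m)%N ->
  p <> 3%N \/ (1 < m)%N ->
  (logn p (k.+3 * k.+2) < k.+1 * m + logn p 2)%N.
Proof.
move=> p_pr m_gt0 hp; have := logn_consecutive_le p k.+1 p_pr.
move: (logn _ _) => e pe; rewrite ltnNge; apply/negP => le_e.
have pow2 j : (j.+3 < 2 ^ j.+2)%N by elim: j => // j; rewrite [(2 ^ j.+3)%N]expnS; lia.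
(* The exception [j = 0] is the equality [3 = 3 ^ 1]; it corresponds to [e = 1], which [1 < m] rules
   out below. *)
have pow3 j : (j.+3 < 3 ^ j.+1)%N || (j == 0)%N.
  by elim: j => // -[|j] //; rewrite [(3 ^ j.+3)%N]expnS; lia.
have pow5 j : (j.+3 < 5 ^ j.+1)%N by elim: j => // j; rewrite [(5 ^ j.+2)%N]expnS; lia.
have [p2|p2] := eqVneq p 2%N.
  move: pe le_e; rewrite p2 logn_prime //=; case: e => [|[|e]]; try nia.
  by have := pow2 e; nia.
have [p3|p3] := eqVneq p 3%N.
  move: pe le_e; rewrite p3; case: e => [|[|e]]; try nia.
  by have := pow3 e.+1; nia.
have p5 : (5 <= p)%N.
  have p4 : p != 4%N by apply: contraTneq p_pr => ->.
  by move: (prime_gt1 p_pr) p2 p3 p4; lia.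
case: e pe le_e => [|e] pe le_e; first by nia.
have : (5 ^ e.+1 <= p ^ e.+1)%N by rewrite leq_exp2r.
by have := pow5 e; nia.
Qed.

Lemma bin_falling2 (n k : nat) :
  (k.+2 * k.+1 * 'C(n.+2, k.+2) = n.+2 * n.+1 * 'C(n, k))%N.
Proof.
have := mul_bin_diag n.+2 k.+1; have := mul_bin_diag n.+1 k => /= e1 e2.
by rewrite mulnAC -e2 -!mulnA [('C(_, _) * _)%N]mulnC -e1.
Qed.

(** Multiplied by [T], both sides become [T.+1 ^ n.+2 - 1]; cancelling [T] requires treating [T = 0]
    apart. *)
Lemma geometric_sum_binomial (T n : nat) :
  (\sum_(i < n.+2) T.+1 ^ i =
   n.+2 + 'C(n.+2, 2) * T + \sum_(k < n) 'C(n.+2, k.+3) * T ^ k.+2)%N.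
Proof.
have [->|T_gt0] := posnP T.
  rewrite muln0 addn0 (eq_bigr (fun=> 1%N)) => [|i _]; last by rewrite exp1n.
  rewrite sum_nat_const card_ord muln1 big1 ?addn0 // => i _.
  by rewrite exp0n ?muln0.
apply/eqP; rewrite -(eqn_pmul2l T_gt0); apply/eqP.
have := predn_exp T.+1 n.+2; rewrite /= => <-.
rewrite -[T.+1]add1n expnDn 3!big_ord_recl /= !expn0 bin0 bin1.
have bE (i : nat) : bump 0 (bump 0 (bump 0 i)) = i.+3 by rewrite /bump; lia.
rewrite (eq_bigr (fun i : 'I_n => T * ('C(n.+2, i.+3) * T ^ i.+2)))%N.
  rewrite -big_distrr /= /bump /= !exp1n !mul1n.
  rewrite !addn0 !add1n expn1 -mulnn /= !mulnDr !addnA [(T * n.+2)%N]mulnC.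
  by rewrite [in RHS](mulnC T (_ * T)) mulnA.
by move=> i _; rewrite bE exp1n mul1n [(T ^ i.+3)%N]expnS; lia.
Qed.

(** By [bin_falling2], passing from [n.+2 * n.+1] to ['C(n.+2, k.+3)] loses at most the valuation of
    [k.+3 * k.+2]; by [logn_consecutive_lt] the factors 2 and [T ^ k.+1] more than make up for
    it. *)
Lemma dvdn_higher_binomial_term (p T n k : nat) : prime p -> (0 < T)%N ->
  (p %| T)%N -> p <> 3%N \/ (p ^ 2 %| T)%N -> (k < n)%N ->
  (p ^ (logn p (n.+2 * n.+1 * T)).+1 %| 2 * ('C(n.+2, k.+3) * T ^ k.+2))%N.
Proof.
move=> p_pr T_gt0 pT hp kn.
have m_gt0 : (0 < logn p T)%N by rewrite logn_gt0 mem_primes p_pr T_gt0.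
have {}hp : p <> 3%N \/ (1 < logn p T)%N.
  by case: hp => [|p2T]; [left | right; rewrite -pfactor_dvdn].
have C_gt0 : (0 < 'C(n.+2, k.+3))%N by rewrite bin_gt0.
have C'_gt0 : (0 < 'C(n, k.+1))%N by rewrite bin_gt0.
have := congr1 (logn p) (bin_falling2 n k.+1).
have := logn_consecutive_lt p _ k p_pr m_gt0 hp.
move: C_gt0 C'_gt0; move: 'C(n.+2, _) 'C(n, _) => C C' C_gt0 C'_gt0.
have Tk_gt0 : (0 < T ^ k.+2)%N by rewrite expn_gt0 T_gt0.
have CT_gt0 : (0 < C * T ^ k.+2)%N by rewrite muln_gt0 C_gt0.
rewrite pfactor_dvdn ?(muln_gt0 2) // [logn p (2 * _)]lognM //.
rewrite [logn p (C * _)]lognM // lognX [logn p (_ * T)]lognM //.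
rewrite [logn p (_ * C)]lognM // [logn p (_ * C')]lognM //.
nia.
Qed.

(* Integer version of the theorem, with the fixed-point equation relaxed to a
   congruence. *)
Lemma dvdn_geometric_sum_sub (p T n M : nat) : prime p ->
  (p %| T)%N -> p <> 3%N \/ (p ^ 2 %| T)%N ->
  (\sum_(i < n) T.+1 ^ i = n %[mod p ^ M])%N ->
  (p ^ M %| n * n.-1 * T)%N.
Proof.
move=> p_pr pT hp; case: n => [|[|n]]; rewrite ?muln0 ?mul0n //.
have [->|T_gt0] := posnP T; first by rewrite muln0.
(* Cancelling [n.+2] and doubling turns the quadratic term into [n.+2 * n.+1 * T]. *)
rewrite geometric_sum_binomial -addnA -[X in _ = X %[mod _]]addn0.
move/eqP; rewrite eqn_modDl mod0n => /(dvdn_mull 2).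
rewrite mulnDr big_distrr /= mulnA.
have -> : (2 * 'C(n.+2, 2) = n.+2 * n.+1)%N.
  by have := bin_falling2 n 0; rewrite bin0 !muln1.
set R := (\sum_(i < n) _)%N => dvd_sum.
have dvdR : (p ^ (logn p (n.+2 * n.+1 * T)).+1 %| R)%N.
  by apply: dvdn_sum => i _; exact: dvdn_higher_binomial_term.
(* If [M] exceeded the valuation of [n.+2 * n.+1 * T], the next power of [p] would divide both the
   sum and [R], hence that product. *)
have [MV|VM] := leqP M (logn p (n.+2 * n.+1 * T)).
  by rewrite pfactor_dvdn // !muln_gt0.
have := dvdn_trans (dvdn_exp2l p VM) dvd_sum.
by rewrite dvdn_addl // pfactor_dvdn ?muln_gt0 // ltnn.
Qed.

Lemma dvdn_natr_Zp (p n a : nat) : prime p ->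
  (a%:R == 0 :> 'Z_(p ^ n.+1)) = (p ^ n.+1 %| a)%N.
Proof.
move=> p_pr; have pn_gt1 : (1 < p ^ n.+1)%N.
  by rewrite -[1%N](expn0 p) ltn_exp2l // prime_gt1.
by rewrite -val_eqE /= val_Zp_nat.
Qed.

Lemma padic_neq0P (p : nat) (x : padic p) : x <> 0 -> exists n, x n != 0.
Proof.
move=> x_neq0; apply: contrapT => xn0; apply: x_neq0; apply: padic_ext => n.
by apply/eqP/negPn/negP => xn; apply: xn0; exists n.
Qed.

Lemma padic_eq0P (p n m : nat) (x : padic p) : prime p ->
  (x n == 0) = (p ^ n.+1 %| x (n + m)%N)%N.
Proof. by move=> p_pr; rewrite (residue_mod p_pr x n m) dvdn_natr_Zp. Qed.

Lemma padic_mulf_eq0 (p : nat) (x y : padic p) : prime p ->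
  x * y = 0 -> x = 0 \/ y = 0.
Proof.
move=> p_pr xy0; have [->|/padic_neq0P[a xa]] := pselect (x = 0); first by left.
right; apply: padic_ext => n; apply/eqP; move: xa.
(* Both residues are read at the common level [n + a + 1]: there [p ^ (n + a).+2] divides the
   product while [x] has valuation at most [a], which leaves at least [n.+2] for [y]. *)
rewrite (padic_eq0P p n a.+1) // (padic_eq0P p a n.+1) // !addnS [(a + n)%N]addnC.
have : (p ^ (n + a).+2 %| x (n + a).+1 * y (n + a).+1)%N.
  by rewrite -dvdn_natr_Zp // natrM !natr_Zp -residueM xy0.
move: (x _ : nat) (y _ : nat) => u v; have [-> //|v_gt0] := posnP v.
have [->|u_gt0] := posnP u; first by rewrite dvdn0.
by rewrite !pfactor_dvdn ?muln_gt0 ?u_gt0 // lognM //; lia.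
Qed.

Lemma iota_q_residue (p : nat) (q z : padic p) (n : nat) : prime p -> U 1 q ->
  exists a : nat, z n = a%:R /\ iota_q q z n = qsum q a n.
Proof.
move=> p_pr qU; have [iota_cont iota_nat] := iota_qP p_pr qU.
have [|m hm] := iota_cont z (pcoset n.+1 (iota_q q z)); first by exists n.+1.
(* Level [n + m] is deep enough both for [z n] and for the modulus of continuity [m]. *)
exists (z (n + m)%N); split; first exact: residue_mod.
rewrite -iota_nat; apply/(pcosetP p_pr)/hm/(pcoset_le _ (pcoset_natr p_pr (n + m) z)).
by rewrite leqW // leq_addl.
Qed.

Lemma residueX (p : nat) (x : padic p) (k n : nat) : (x ^+ k) n = x n ^+ k.
Proof. by elim: k => // k IH; rewrite !exprS residueM IH. Qed.

Lemma residue_qsum (p : nat) (q : padic p) (a n T : nat) :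
  q n = T%:R -> qsum q a n = (\sum_(i < a) T ^ i)%N%:R.
Proof.
move=> qT; rewrite /qsum; elim: a => [|a IH]; first by rewrite !big_ord0.
by rewrite !big_ord_recr /= natrD -IH residueX qT natrX.
Qed.

Lemma natr_eq_Zp (p n a b : nat) : prime p ->
  (a%:R : 'Z_(p ^ n.+1)) = b%:R -> (a = b %[mod p ^ n.+1])%N.
Proof.
move=> p_pr /(congr1 val); have pn_gt1 : (1 < p ^ n.+1)%N.
  by rewrite -[1%N](expn0 p) ltn_exp2l // prime_gt1.
by rewrite /= !val_Zp_nat.
Qed.

(** The exponent [e] merges the two hypotheses of the theorem: 1 if [p] is not 3, and 2 if [q] lies
    in [U 2]. *)
Lemma fixed_point_eq0 (p e : nat) (q z : padic p) : prime p ->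
  (0 < e)%N -> p <> 3%N \/ (1 < e)%N -> U e q -> U 1 q ->
  iota_q q z = z -> z * (z - 1) * (q - 1) = 0.
Proof.
move=> p_pr e_gt0 hpe [u _ qE] qU fix_z; apply: padic_ext => n.
have [a [za ia]] := iota_q_residue p q z n p_pr qU.
(* A natural number representing [q - 1] at level [n], chosen visibly divisible by [p ^ e]. *)
pose T := (p ^ e * u n)%N.
have tT : (q - 1) n = T%:R.
  by rewrite -qE addrC addKr residueM -natrX residue_nat natrM natr_Zp.
have qT : q n = T.+1%:R by rewrite -[q](subrK 1) residueD tT -natr1.
move: ia; rewrite fix_z za (residue_qsum p q a n T.+1 qT).
move=> /(natr_eq_Zp _ _ _ _ p_pr) aE.
have pT : (p %| T)%N by rewrite dvdn_mulr // dvdn_exp.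
have pT2 : p <> 3%N \/ (p ^ 2 %| T)%N.
  by case: hpe => [|e_gt1]; [left | right; rewrite dvdn_mulr // dvdn_exp2l].
have := dvdn_geometric_sum_sub p T a n.+1 p_pr pT pT2 (esym aE).
rewrite -dvdn_natr_Zp //; move: T tT {qT aE pT pT2} => T tT.
rewrite !natrM => /eqP aT.
rewrite !residueM residueB tT za; apply: etrans aT; congr (_ * _).
(* For [a = 0] the truncated [a.-1] does not represent [z - 1], but both products vanish. *)
case: a {za} => [|a]; first by rewrite !mul0r.
by rewrite -[a.+1%:R in X in _ * X]natr1 addrK.
Qed.

Theorem corollary4p4 (p : nat) (p_prime : prime p) (q : padic p)
    (q_in_U1 : U 1 q) (q_neq1 : q <> 1)
    (hpq : p <> 3%N \/ U 2 q) :
  [set z : padic p | iota_q q z = z] = [set 0; 1].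
Proof.
have [_ iota_nat] := iota_qP p_prime q_in_U1.
apply/seteqP; split=> [z /= fix_z|z /= []->]; last 2 first.
- by rewrite (iota_nat 0%N) /qsum big_ord0.
- by rewrite (iota_nat 1%N) /qsum big_ord1.
have /(padic_mulf_eq0 _ _ _ p_prime)[] : z * (z - 1) * (q - 1) = 0.
  case: hpq => [p_neq3|q_in_U2]; first by apply: (fixed_point_eq0 p 1) => //; left.
  by apply: (fixed_point_eq0 p 2) => //; right.
- by move=> /(padic_mulf_eq0 _ _ _ p_prime)[->|/subr0_eq->]; [left | right].
- by move=> /subr0_eq.
Qed.
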